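(* Let $z,q$ be complex numbers with $z\neq 0$ and $|q|<1$. Then $$\prod_{n=0}^{\infty}(1+zq^{n+1})(1+z^{-1}q^{n})(1-q^{n+1})=\sum_{n=-\infty}^{\infty}z^nq^{\frac{n^2+n}{2}}.$$
   Context: Convention $0^0=1$. *)

(* Defs.v *)
From HB Require Import structures.
From mathcomp Require Import all_boot all_order all_algebra.
From mathcomp Require Import complex.
From mathcomp Require Import all_classical all_reals all_analysis.

Set Implicit Arguments.
Unset Strict Implicit.
Unset Printing Implicit Defensive.

Import Order.TTheory GRing.Theory Num.Theory.
Import numFieldNormedType.Exports.

Local Open Scope classical_set_scope.
Local Open Scope complex_scope.
Local Open Scope ring_scope.

(* [R[i]^o] is [R[i]] with the topology given by the complex modulus. *)

(* The limit is allowed to be 0, since finitely many factors may vanish. *)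
Definition infprod_to (R : realType) (f : nat -> R[i]) (l : R[i]^o) : Prop :=
  (fun N : nat => \prod_(n < N) f n : R[i]^o) @ \oo --> l.

(* The partial sums over -M <= n < N, with M and N tending to infinity
   independently, converge to [l]. *)
Definition bisum_to (R : realType) (f : int -> R[i]) (l : R[i]^o) : Prop :=
  (fun MN : nat * nat =>
     \sum_(m < MN.1) f (- m.+1%:Z) + \sum_(n < MN.2) f n%:Z : R[i]^o)
  @ (\oo, \oo) --> l.

(* Main.v *)
Require Import Defs.
From HB Require Import structures.
From mathcomp Require Import all_boot all_order all_algebra.
From mathcomp Require Import complex.
From mathcomp Require Import all_classical all_reals all_analysis.
From mathcomp Require Import ring lra zify.

Set Implicit Arguments.
Unset Strict Implicit.
Unset Printing Implicit Defensive.

Import Order.TTheory GRing.Theory Num.Theory.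
Import numFieldNormedType.Exports.

Local Open Scope classical_set_scope.
Local Open Scope complex_scope.
Local Open Scope ring_scope.

(** This is the Jacobi triple product.  It is the limit, as [N] grows, of an
    exact identity for the partial products.  By the q-binomial theorem
    ([prod_theta_qbinom]), the product of the first [N] factors is
    the sum over [|k| <= N] of [z ^ k * q ^ (k(k+1)/2)] times a weight
    [(q)_N * (q)_(2N) / ((q)_(N-k) * (q)_(N+k))], where [(q)_n] denotes
    [(1 - q) (1 - q^2) ... (1 - q^n)]; this is [finite_jacobi].

    Both ratios [(q)_N / (q)_(N-k)] and [(q)_(2N) / (q)_(N+k)] are products of
    factors [1 - q^i] with [i > N - k], so the weight differs from [1] by
    [O(r^(N-k))] for any positive [r] with [|q| <= r < 1]
    ([jacobi_weight_near1]).  On the other hand the Gaussian factor makes the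
    [k]-th term of the series [O(r^(2k))] ([jacobi_term_bound]).  Multiplying
    these, the [N]-th partial product and the [N]-th symmetric partial sum
    differ by a constant times the sum over [k] of
    [r^(2k) * r^(N-k) = r^N * r^k], which is [O(r^N)]
    ([jacobi_product_sum_dist]).  The terms being dominated by a geometric
    sequence, the bilateral series converges, and the product must converge to
    the same limit. *)

(** * A finite form of the triple product *)

(** Multiplying a polynomial by a binomial adds a shifted copy of its
    coefficients: this is the bookkeeping of that step, with [f] the unshifted
    part and [g] the shifted one. *)
Lemma sum_ord_shift (V : nmodType) (m : nat) (f g h : nat -> V) :
    h 0%N = f 0%N -> f m.+1 = 0 ->
    (forall j, (j <= m)%N -> h j.+1 = f j.+1 + g j) ->
  \sum_(j < m.+2) h j = \sum_(j < m.+1) f j + \sum_(j < m.+1) g j.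
Proof.
move=> h0 fm hS.
have -> : \sum_(j < m.+1) f j = \sum_(j < m.+2) f j.
  by rewrite [RHS]big_ord_recr /= fm addr0.
rewrite big_ord_recl [X in _ = X + _]big_ord_recl -addrA h0 -big_split /=.
by congr (_ + _); apply: eq_bigr => j _; rewrite hS // -ltnS.
Qed.

Section FiniteIdentity.
Context {F : fieldType}.
Implicit Types (q z : F) (m n j k M N : nat).

(** The q-Pochhammer symbol [(q; q)_n]. *)
Definition qpoch q n : F := \prod_(i < n) (1 - q ^+ i.+1).

Definition qbinom q m j : F :=
  if (j <= m)%N then qpoch q m / (qpoch q j * qpoch q (m - j)) else 0.

(** The triangular number [k(k+1)/2] at the possibly negative integer
    [k = j - M]: one of the two truncated differences is [0], which makes the
    corresponding binomial coefficient vanish. *)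
Definition centered_tri M j : nat := ('C((j - M).+1, 2) + 'C(M - j, 2))%N.

Lemma qpochS q n : qpoch q n.+1 = qpoch q n * (1 - q ^+ n.+1).
Proof. by rewrite /qpoch big_ord_recr. Qed.

Lemma qpoch0 q : qpoch q 0 = 1.
Proof. by rewrite /qpoch big_ord0. Qed.

Section Qbinom.
Variable q : F.
(* No positive power of [q] equals [1], so the Gaussian binomials are genuine
   quotients. *)
Hypothesis q_unity : forall n, 1 - q ^+ n.+1 != 0.

Lemma qpoch_neq0 n : qpoch q n != 0.
Proof. by apply/prodf_neq0 => i _; apply: q_unity. Qed.

Lemma qbinom0 m : qbinom q m 0 = 1.
Proof. by rewrite /qbinom /= subn0 qpoch0 mul1r divff ?qpoch_neq0. Qed.

Lemma qbinomnn m : qbinom q m m = 1.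
Proof. by rewrite /qbinom leqnn subnn qpoch0 mulr1 divff ?qpoch_neq0. Qed.

Lemma qbinom_small m j : (m < j)%N -> qbinom q m j = 0.
Proof. by move=> mj; rewrite /qbinom leqNgt mj. Qed.

(** Holds since
    [1 - q^(m+1) = (1 - q^(j+1)) + q^(j+1) * (1 - q^(m-j))]; the other Pascal
    rule comes from exchanging [j + 1] and [m - j]. *)
Lemma qbinom_pascall m j :
  qbinom q m.+1 j.+1 = qbinom q m j + q ^+ j.+1 * qbinom q m j.+1.
Proof.
have [jm|mj|->] := ltngtP j m; last 2 first.
- by rewrite !qbinom_small ?mulr0 ?addr0 // ltnS ltnW.
- by rewrite !qbinomnn qbinom_small // mulr0 addr0.
rewrite /qbinom ltnS jm (ltnW jm) subSS.
have -> : (m - j = (m - j.+1).+1)%N by rewrite subnSK.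
rewrite !qpochS.
have -> : q ^+ m.+1 = q ^+ j.+1 * q ^+ (m - j.+1).+1.
  by rewrite -exprD; congr (_ ^+ _); lia.
have := qpoch_neq0 j; have := qpoch_neq0 (m - j.+1).
have := q_unity j; have := q_unity (m - j.+1).
by move=> *; field; do !(apply/andP; split).
Qed.

Lemma qbinom_pascalr m j : (j <= m)%N ->
  qbinom q m.+1 j.+1 = qbinom q m j.+1 + q ^+ (m - j) * qbinom q m j.
Proof.
rewrite leq_eqVlt => /predU1P[->|jm].
  by rewrite !qbinomnn qbinom_small // subnn mul1r add0r.
rewrite /qbinom ltnS jm (ltnW jm) subSS.
have -> : (m - j = (m - j.+1).+1)%N by rewrite subnSK.
rewrite !qpochS.
have -> : q ^+ m.+1 = q ^+ j.+1 * q ^+ (m - j.+1).+1.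
  by rewrite -exprD; congr (_ ^+ _); lia.
have := qpoch_neq0 j; have := qpoch_neq0 (m - j.+1).
have := q_unity j; have := q_unity (m - j.+1).
by move=> *; field; do !(apply/andP; split).
Qed.

(** This is [T(k+1) = T(k) + (k+1)] for [k = j - M] and [T] the triangular
    numbers, with [M] moved across to stay in the natural numbers. *)
Lemma centered_triS M j :
  (centered_tri M j.+1 + M = centered_tri M j + j.+1)%N.
Proof.
rewrite /centered_tri; have [jM|Mj] := ltnP j M.
  have -> : (j.+1 - M = 0)%N by lia.
  have -> : (j - M = 0)%N by lia.
  have -> : (M - j = (M - j.+1).+1)%N by lia.
  rewrite (binS (M - j.+1)) bin1; lia.
have -> : (j.+1 - M = (j - M).+1)%N by lia.
have -> : (M - j = 0)%N by lia.
have -> : (M - j.+1 = 0)%N by lia.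
rewrite (binS (j - M).+1) bin1; lia.
Qed.

(** The q-binomial theorem, written without negative exponents: the first
    product is that of the [1 + z^-1 * q ^ i] multiplied by [z ^ M].
    Each added factor is absorbed by one of the two Pascal rules, which is why
    the two products are built up by separate inductions. *)
Lemma prod_theta_qbinom z M N :
  \prod_(i < M) (z + q ^+ i) * \prod_(n < N) (1 + z * q ^+ n.+1) =
  \sum_(j < (M + N).+1) z ^+ j * q ^+ centered_tri M j * qbinom q (M + N) j.
Proof.
elim: N => [|N IHN].
  rewrite big_ord0 mulr1 addn0; elim: M => [|M IHM].
    by rewrite big_ord0 big_ord1 qbinom0 !mul1r.
  rewrite big_ord_recr /= IHM mulrDr.
  rewrite [X in X + _]mulr_suml [X in _ + X]mulr_suml addrC.
  symmetry; apply: (@sum_ord_shift _ M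
   (fun j => z ^+ j * q ^+ centered_tri M j * qbinom q M j * q ^+ M)
   (fun j => z ^+ j * q ^+ centered_tri M j * qbinom q M j * z)
   (fun j => z ^+ j * q ^+ centered_tri M.+1 j * qbinom q M.+1 j)).
  - rewrite !qbinom0 !mulr1 !mul1r -exprD; congr (_ ^+ _).
    by rewrite /centered_tri !sub0n !subn0 (binS M) bin1 addnA.
  - by rewrite qbinom_small // mulr0 mul0r.
  - move=> j jM /=; rewrite qbinom_pascall.
    rewrite {1}/centered_tri !subSS -/(centered_tri M j).
    rewrite mulrDr addrC; congr (_ + _); first by rewrite (exprS z); ring.
    rewrite -!mulrA; congr (_ * _).
    by rewrite [_ * q ^+ M]mulrC !mulrA -!exprD centered_triS.
rewrite big_ord_recr /= mulrA IHN mulrDr mulr1 [X in _ + X]mulr_suml addnS.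
symmetry; apply: (@sum_ord_shift _ (M + N)
   (fun j => z ^+ j * q ^+ centered_tri M j * qbinom q (M + N) j)
   (fun j => z ^+ j * q ^+ centered_tri M j * qbinom q (M + N) j
             * (z * q ^+ N.+1))
   (fun j => z ^+ j * q ^+ centered_tri M j * qbinom q (M + N).+1 j)).
- by rewrite !qbinom0.
- by rewrite qbinom_small // mulr0.
- move=> j jm /=; rewrite qbinom_pascalr // mulrDr; congr (_ + _).
  have e : (centered_tri M j.+1 + (M + N - j) = centered_tri M j + N.+1)%N.
    have := centered_triS M j; lia.
  have -> : z ^+ j * q ^+ centered_tri M j * qbinom q (M + N) j *
      (z * q ^+ N.+1) =
      z ^+ j.+1 * (q ^+ centered_tri M j * q ^+ N.+1) * qbinom q (M + N) j.
    by rewrite (exprS z); ring.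
  by rewrite -exprD -e exprD !mulrA.
Qed.

Definition jacobi_term z (n : int) : F :=
  z ^ n * q ^ (((n ^+ 2 + n)%R %/ 2)%Z).

(** The coefficient of the term of index [k] or [-k] in the [N]-th partial
    product; it tends to [1] as [N] grows. *)
Definition jacobi_weight N k : F :=
  qpoch q N * (qpoch q (N + N) / (qpoch q (N - k) * qpoch q (N + k))).

Lemma triangular_divz n : (((n%:Z ^+ 2 + n%:Z)%R %/ 2)%Z) = 'C(n.+1, 2)%:Z.
Proof.
suff -> : (n%:Z ^+ 2 + n%:Z)%R = 'C(n.+1, 2)%:Z * 2 by rewrite mulzK.
have := mul_bin_diag n.+1 1; rewrite bin1 expr2 /=.
lia.
Qed.

Lemma jacobi_term_nat z n : jacobi_term z n%:Z = z ^+ n * q ^+ 'C(n.+1, 2).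
Proof. by rewrite /jacobi_term triangular_divz. Qed.

Lemma jacobi_term_neg z m :
  jacobi_term z (- m.+1%:Z) = z ^- m.+1 * q ^+ 'C(m.+1, 2).
Proof.
rewrite /jacobi_term -[q ^+ _]/(q ^ 'C(m.+1, 2)%:Z) -triangular_divz.
have -> : (- m.+1%:Z) ^+ 2 + - m.+1%:Z = m%:Z ^+ 2 + m%:Z.
  by rewrite -addn1 PoszD; ring.
by [].
Qed.

(** The case [M = N] of [prod_theta_qbinom], recentred at [j = N]: the indices
    [j < N] give the negative powers of [z]. *)
Lemma finite_jacobi z N : z != 0 ->
  \prod_(n < N) ((1 + z * q ^+ n.+1) * (1 + z^-1 * q ^+ n) * (1 - q ^+ n.+1)) =
  \sum_(m < N) jacobi_term z (- m.+1%:Z) * jacobi_weight N m.+1 +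
  \sum_(n < N.+1) jacobi_term z n%:Z * jacobi_weight N n.
Proof.
move=> z0.
have zN0 : z ^+ N != 0 by rewrite expf_neq0.
have -> : \prod_(n < N)
     ((1 + z * q ^+ n.+1) * (1 + z^-1 * q ^+ n) * (1 - q ^+ n.+1)) =
     z ^- N * qpoch q N
     * (\prod_(i < N) (z + q ^+ i) * \prod_(n < N) (1 + z * q ^+ n.+1)).
  have -> : \prod_(i < N) (z + q ^+ i) =
      z ^+ N * \prod_(i < N) (1 + z^-1 * q ^+ i).
    rewrite -[in z ^+ N](card_ord N) -prodr_const -big_split /=.
    by apply: eq_bigr => i _; rewrite mulrDr mulr1 mulVKf.
  by rewrite !big_split /= /qpoch; field.
rewrite prod_theta_qbinom mulr_sumr.
rewrite -addnS big_split_ord /=; congr (_ + _).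
  rewrite (reindex_inj rev_ord_inj) /=; apply: eq_bigr => m _.
  have mN := ltn_ord m.
  rewrite jacobi_term_neg /jacobi_weight /qbinom ifT; last by lia.
  have -> : (N + N - (N - m.+1) = N + m.+1)%N by lia.
  have -> : centered_tri N (N - m.+1) = 'C(m.+1, 2).
    rewrite /centered_tri; have -> : (N - m.+1 - N = 0)%N by lia.
    by rewrite subKn.
  rewrite -[in z ^- N](subnK mN) exprD.
  have z1 : z ^+ (N - m.+1) != 0 by rewrite expf_neq0.
  have z2 : z ^+ m.+1 != 0 by rewrite expf_neq0.
  have := qpoch_neq0 (N - m.+1); have := qpoch_neq0 (N + m.+1).
  by move=> *; field; do !(apply/andP; split).
apply: eq_bigr => n _; have nN : (n <= N)%N by rewrite -ltnS.
rewrite jacobi_term_nat /jacobi_weight /qbinom ifT; last by lia.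
have -> : (N + N - (N + n) = N - n)%N by lia.
have -> : centered_tri N (N + n) = 'C(n.+1, 2).
  rewrite /centered_tri addKn; have -> : (N - (N + n) = 0)%N by lia.
  by rewrite addn0.
rewrite exprD; have := qpoch_neq0 (N - n); have := qpoch_neq0 (N + n).
by move=> *; field; do !(apply/andP; split).
Qed.

End Qbinom.
End FiniteIdentity.

(** * Convergence estimates for the complex modulus *)

Section ComplexModulus.
Context {R : realType}.
Implicit Types (x y : R[i]) (r a K : R).
Local Notation normc := (@Normc.normc R).

Lemma normrc_normc x : `|x| = (normc x)%:C.
Proof. by []. Qed.

Lemma normc_ge0 x : 0 <= normc x.
Proof. by rewrite -lecR -normrc_normc normr_ge0. Qed.

Lemma normcX x n : normc (x ^+ n) = normc x ^+ n.
Proof.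
elim: n => [|n IHn]; first by rewrite !expr0 Normc.normc1.
by rewrite !exprS Normc.normcM IHn.
Qed.

Lemma normc_le_ReIm x : normc x <= `|complex.Re x| + `|complex.Im x|.
Proof.
case: x => a b /=.
rewrite -[leRHS]ger0_norm ?addr_ge0 // -sqrtr_sqr ler_sqrt ?sqr_ge0 //.
rewrite sqrrD !real_normK ?num_real // lerD2r lerDl.
by rewrite mulrn_wge0 // mulr_ge0.
Qed.

Lemma Re_le_normc x : `|complex.Re x| <= normc x.
Proof.
case: x => a b /=; rewrite -sqrtr_sqr ler_sqrt ?addr_ge0 ?sqr_ge0 //.
by rewrite lerDl sqr_ge0.
Qed.

Lemma Im_le_normc x : `|complex.Im x| <= normc x.
Proof.
case: x => a b /=; rewrite -sqrtr_sqr ler_sqrt ?addr_ge0 ?sqr_ge0 //.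
by rewrite lerDr sqr_ge0.
Qed.

Lemma normc_sum (I : Type) (s : seq I) (P : pred I) (f : I -> R[i]) :
  normc (\sum_(i <- s | P i) f i) <= \sum_(i <- s | P i) normc (f i).
Proof.
elim/big_rec2: _ => [|i y x _ xy]; first by rewrite Normc.normc0.
by apply: le_trans (le_normcD _ _) _; rewrite lerD2l.
Qed.

(** The norm on [R[i]] has values in [R[i]]; this reduces convergence there to
    a limit in [R], where the order is total and squeezing is available. *)
Lemma cvg_normcP (T : Type) (F : set_system T) {FF : Filter F}
    (u : T -> R[i]) (l : R[i]) :
  (u : T -> R[i]^o) @ F --> (l : R[i]^o) <->
  normc (l - u t) @[t --> F] --> (0 : R).
Proof.
split=> [/cvgrPdist_lt ul|/cvgr0Pnorm_lt ul].
  apply/cvgr0Pnorm_lt => e e0.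
  have ec0 : 0 < e%:C by rewrite ltcR.
  apply: filterS (ul _ ec0) => t /=; rewrite [X in X < _ -> _]normrc_normc ltcR.
  by rewrite ger0_norm ?normc_ge0.
apply/cvgrPdist_lt => e e0.
have eE : e = (complex.Re e)%:C by rewrite RRe_real // realE ltW.
have re0 : 0 < complex.Re e by rewrite -ltcR -eE.
apply: filterS (ul _ re0) => t /=; rewrite ger0_norm ?normc_ge0 // => ut.
by rewrite [`|_|]normrc_normc eE ltcR.
Qed.

Lemma cvg_geometric_dist (u v : nat -> R[i]) (l : R[i]) K r :
    0 <= r < 1 -> (forall N, normc (u N - v N) <= K * r ^+ N) ->
    (v : nat -> R[i]^o) @ \oo --> (l : R[i]^o) ->
  (u : nat -> R[i]^o) @ \oo --> (l : R[i]^o).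
Proof.
move=> /andP[r0 r1] uv /cvg_normcP vl; apply/cvg_normcP.
apply: (@squeeze_cvgr _ _ _ _ (fun=> 0)
  (fun N => normc (l - v N) + geometric K r N)); last 2 first.
- exact: cvg_cst.
- rewrite -[0 : R]addr0; apply: cvgD => //.
  by apply: cvg_geometric; rewrite ger0_norm.
near=> N; rewrite normc_ge0 /=.
have -> : l - u N = (l - v N) - (u N - v N) by ring.
by apply: le_trans (le_normcD _ _) _; rewrite normcN lerD2l uv.
Unshelve. all: by end_near. Qed.

(** Real and imaginary parts converge absolutely, by comparison with the
    geometric series. *)
Lemma cvg_geometric_series_normc (u : nat -> R[i]) K r :
    0 <= r < 1 -> (forall n, normc (u n) <= K * r ^+ n) ->
  exists l : R[i], (fun N => \sum_(n < N) u n : R[i]^o) @ \oo --> (l : R[i]^o).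
Proof.
move=> /andP[r0 r1] uK.
have part (p : {additive R[i] -> R}) : (forall x, `|p x| <= normc x) ->
    exists a, (fun N => p (\sum_(n < N) u n)) @ \oo --> (a : R).
  move=> pn; exists (limn (series (p \o u))).
  have -> : (fun N => p (\sum_(n < N) u n)) = series (p \o u).
    by apply/funext => N; rewrite raddf_sum /series /= big_mkord.
  apply: normed_cvg.
  apply: (@series_le_cvg _ _ (geometric K r)) => [n|n|n|] /=.
  - exact: normr_ge0.
  - exact: le_trans (normc_ge0 _) (uK n).
  - exact: le_trans (pn _) (uK n).
  - by apply: is_cvg_geometric_series; rewrite ger0_norm.
have [a ua] := part (@complex.Re R) Re_le_normc.
have [b ub] := part (@complex.Im R) Im_le_normc.
exists (a +i* b); apply/cvg_normcP.
set s := fun N => \sum_(n < N) u n.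
apply: (@squeeze_cvgr _ _ _ _ (fun=> 0)
  (fun N => `|a - complex.Re (s N)| + `|b - complex.Im (s N)|)); last 2 first.
- exact: cvg_cst.
- rewrite -[0 : R]addr0; apply: cvgD.
    rewrite -(normr0 R) -(subrr a); apply: cvg_norm; apply: cvgB => //.
    exact: cvg_cst.
  rewrite -(normr0 R) -(subrr b); apply: cvg_norm; apply: cvgB => //.
  exact: cvg_cst.
near=> N; rewrite normc_ge0 /=; apply: le_trans (normc_le_ReIm _) _.
by rewrite !raddfB.
Unshelve. all: by end_near. Qed.

(** Expanding the product, every monomial on the left is dominated by the
    corresponding one of the product of the [1 + |x i|], itself bounded by the
    exponential of the sum. *)
Lemma normc_prod1B_sub1 (x : nat -> R[i]) n :
  normc (\prod_(i < n) (1 - x i) - 1) <= expR (\sum_(i < n) normc (x i)) - 1.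
Proof.
elim: n => [|n IHn]; first by rewrite !big_ord0 subrr Normc.normc0 expR0 subrr.
rewrite !big_ord_recr /=; set P := \prod_(i < n) _ in IHn *.
set S := \sum_(i < n) _ in IHn *; set y := x n.
have -> : P * (1 - y) - 1 = (P - 1) - P * y by ring.
have P_le : normc P <= expR S.
  rewrite -[P](subrK 1); apply: le_trans (le_normcD _ _) _.
  by rewrite Normc.normc1 -lerBrDr.
apply: le_trans (le_normcD _ _) _; rewrite normcN Normc.normcM expRD.
have step : normc P * normc y <= expR S * normc y.
  by rewrite ler_wpM2r ?normc_ge0.
have : expR S * (1 + normc y) <= expR S * expR (normc y).
  by rewrite ler_wpM2l ?expR_ge0 ?expR_ge1Dx.
lra.
Qed.

Lemma expR_sub1_le a : expR a - 1 <= a * expR a.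
Proof.
have := expR_ge1Dx (- a); rewrite expRN => h.
have := ler_wpM2r (expR_ge0 a) h; rewrite mulVf ?gt_eqF ?expR_gt0 //.
lra.
Qed.

Lemma sum_expr_le r n : 0 < r < 1 -> \sum_(i < n) r ^+ i <= (1 - r)^-1.
Proof.
move=> /andP[r0 r1].
have -> : \sum_(i < n) r ^+ i = series (geometric 1 r) n.
  by rewrite /series /= big_mkord; apply: eq_bigr => i _; rewrite mul1r.
by rewrite -[leRHS]mul1r; apply: geometric_le_lim => //; rewrite gtr0_norm.
Qed.

(** The first [n0 + 1] quotients [u i / r ^ i], with [n0] the rank from which
    the ratio condition holds, are absorbed into the constant by summing
    them. *)
Lemma geometric_bound (u : nat -> R) r : 0 < r -> (forall n, 0 <= u n) ->
    (\forall n \near \oo, u n.+1 <= r * u n) ->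
  exists2 C, 0 <= C & forall n, u n <= C * r ^+ n.
Proof.
move=> r0 u0 [n0 _ ur].
have t0 i : 0 <= u i / r ^+ i by rewrite divr_ge0 // exprn_ge0 // ltW.
exists (\sum_(i < n0.+1) u i / r ^+ i); first exact: sumr_ge0.
elim=> [|n IHn].
  rewrite expr0 mulr1 big_ord_recl expr0 divr1 lerDl; exact: sumr_ge0.
have [nn0|n0n] := ltnP n n0.
  rewrite -ler_pdivrMr ?exprn_gt0 //.
  by rewrite (bigD1 (Ordinal (nn0 : (n.+1 < n0.+1)%N))) //= lerDl sumr_ge0.
apply: le_trans (ur n n0n) _; rewrite exprS mulrCA ler_wpM2l //.
exact: ltW.
Qed.

(** The ratio of consecutive terms is [a * r ^ n], which tends to [0] and so
    ends up below [r ^ 2]. *)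
Lemma gaussian_bound a r : 0 <= a -> 0 < r < 1 ->
  exists2 C, 0 <= C & forall n, a ^+ n * r ^+ 'C(n, 2) <= C * (r ^+ 2) ^+ n.
Proof.
move=> a0 /andP[r0 r1]; have r0' := ltW r0.
apply: (@geometric_bound (fun n => a ^+ n * r ^+ 'C(n, 2))).
- by rewrite exprn_gt0.
- by move=> n; rewrite mulr_ge0 ?exprn_ge0.
have ar : geometric a r @ \oo --> 0 by apply: cvg_geometric; rewrite gtr0_norm.
have r2 : 0 < r ^+ 2 by rewrite exprn_gt0.
near=> n.
have : `|geometric a r n| < r ^+ 2 by near: n; exact: (cvgr0_norm_lt _ ar).
rewrite /= ger0_norm ?mulr_ge0 ?exprn_ge0 // => /ltW arn.
rewrite binS bin1 exprD exprS.
have -> : a * a ^+ n * (r ^+ 'C(n, 2) * r ^+ n)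
   = (a * r ^+ n) * (a ^+ n * r ^+ 'C(n, 2)) by ring.
by rewrite ler_wpM2r // mulr_ge0 ?exprn_ge0.
Unshelve. all: by end_near. Qed.

End ComplexModulus.

(** * Comparing the partial products with the partial sums *)

Section Convergence.
Context {R : realType}.
Variables (z q : R[i]).
Hypotheses (z_neq0 : z != 0) (q_lt1 : `|q| < 1).
Local Notation normc := (@Normc.normc R).
Local Notation term := (jacobi_term q z).

Lemma normc_q_lt1 : normc q < 1.
Proof. by rewrite -ltcR -normrc_normc. Qed.

Lemma onem_expr_neq0 n : 1 - q ^+ n.+1 != 0.
Proof.
rewrite subr_eq0; apply/eqP => /(congr1 normc).
rewrite Normc.normc1 normcX => /esym/eqP; apply/negP.
by rewrite lt_eqF // exprn_ilt1 ?normc_ge0 ?normc_q_lt1.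
Qed.

(** A rate strictly between [0] and [1] dominating [|q|]. Taking [|q|] itself
    would fail at [q = 0], where powers of the rate could not be divided
    out. *)
Definition ratio : R := Num.max (normc q) 2^-1.

Lemma ratio_itv : 0 < ratio < 1.
Proof.
rewrite /ratio lt_max gt_max normc_q_lt1 invr_gt0 ltr0n orbT /=.
by rewrite invf_lt1 ?ltr1n.
Qed.

Lemma normc_qX_le n : normc (q ^+ n) <= ratio ^+ n.
Proof.
by rewrite normcX lerXn2r ?nnegrE ?normc_ge0 // ?le_max ?lexx // normc_ge0.
Qed.

(** The quotient is the product of the [1 - q ^ i] for [m < i <= m + n], and
    the moduli of these [q ^ i] add up to at most a constant multiple of
    [ratio ^ m], uniformly in [n]. *)
Lemma qpoch_ratio_near1 : exists2 E : R, 0 <= E &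
  forall m n, normc (qpoch q (m + n) / qpoch q m - 1) <= E * ratio ^+ m.
Proof.
have /andP[r0 r1] := ratio_itv; set r := ratio in r0 r1 *.
have r0' := ltW r0; have c0 : 0 <= (1 - r)^-1 by rewrite invr_ge0 subr_ge0 ltW.
exists ((1 - r)^-1 * expR (1 - r)^-1); first by rewrite mulr_ge0 ?expR_ge0.
move=> m n.
have -> : qpoch q (m + n) / qpoch q m = \prod_(i < n) (1 - q ^+ (m + i).+1).
  rewrite /qpoch big_split_ord /= mulrAC divff ?mul1r //.
  exact: qpoch_neq0 onem_expr_neq0 m.
apply: le_trans (normc_prod1B_sub1 (fun i => q ^+ (m + i).+1) n) _.
set S := \sum_(i < n) _.
have SE : S <= r ^+ m * (1 - r)^-1.
  apply: (@le_trans _ _ (r ^+ m * \sum_(i < n) r ^+ i)); last first.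
    by rewrite ler_wpM2l ?exprn_ge0 // sum_expr_le ?r0.
  rewrite mulr_sumr; apply: ler_sum => i _; rewrite -exprD.
  apply: le_trans (normc_qX_le _) _.
  by rewrite exprS ler_piMl ?exprn_ge0 // ltW.
have S1 : S <= (1 - r)^-1.
  apply: le_trans SE _; rewrite ler_piMl // exprn_ile1 //; exact: ltW.
have S0 : 0 <= S by apply: sumr_ge0 => i _; apply: normc_ge0.
apply: le_trans (expR_sub1_le _) _.
rewrite [_ * r ^+ m]mulrC mulrA ler_pM ?expR_ge0 // ler_expR //.
Qed.

(** The weight is the product of [(q)_N / (q)_(N-k)] and
    [(q)_(2N) / (q)_(N+k)], each close to [1] by [qpoch_ratio_near1]. *)
Lemma jacobi_weight_near1 : exists2 D : R, 0 <= D &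
  forall N k, (k <= N)%N ->
    normc (jacobi_weight q N k - 1) <= D * ratio ^+ (N - k).
Proof.
have [E E0 hE] := qpoch_ratio_near1.
have /andP[r0 r1] := ratio_itv; set r := ratio in r0 r1 hE *.
have r0' := ltW r0; have r1' := ltW r1.
exists (E * E + E + E); first by rewrite !addr_ge0 ?mulr_ge0.
move=> N k kN.
have := hE (N - k)%N k; rewrite subnK //.
have := hE (N + k)%N (N - k)%N.
have -> : (N + k + (N - k) = N + N)%N by lia.
set X := qpoch q N / _; set Y := qpoch q (N + N) / _ => hY hX.
have -> : jacobi_weight q N k - 1 = (X - 1) * (Y - 1) + (X - 1) + (Y - 1).
  by rewrite /jacobi_weight invfM /X /Y; ring.
have {}hY : normc (Y - 1) <= E * r ^+ (N - k).
  apply: le_trans hY _; rewrite ler_wpM2l // ler_wiXn2l // leq_subLR; lia.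
have hY' : normc (Y - 1) <= E.
  by apply: le_trans hY _; rewrite ler_piMr // exprn_ile1.
have hXY : normc (X - 1) * normc (Y - 1) <= E * r ^+ (N - k) * E.
  by rewrite ler_pM ?normc_ge0.
have h1 := le_normcD ((X - 1) * (Y - 1) + (X - 1)) (Y - 1).
have h2 := le_normcD ((X - 1) * (Y - 1)) (X - 1).
rewrite Normc.normcM in h2.
lra.
Qed.

(** The rate [ratio ^ 2], rather than [ratio], is what compensates for the
    weights of index [k] near [N], whose distance to [1] is only
    [O(ratio ^ (N - k))]. *)
Lemma jacobi_term_bound : exists2 C : R, 0 <= C &
  forall n, normc (term n%:Z) <= C * (ratio ^+ 2) ^+ n
         /\ normc (term (- n.+1%:Z)) <= C * (ratio ^+ 2) ^+ n.+1.
Proof.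
have r01 := ratio_itv; have [r0 r1] := andP r01.
have r0' := ltW r0; have r1' := ltW r1.
have [C1 C10 h1] := @gaussian_bound R _ _ (normc_ge0 z) r01.
have [C2 C20 h2] := @gaussian_bound R _ _ (normc_ge0 z^-1) r01.
have r2n n : 0 <= (ratio ^+ 2) ^+ n by rewrite !exprn_ge0.
exists (C1 + C2); first exact: addr_ge0.
move=> n; split.
  rewrite jacobi_term_nat Normc.normcM normcX.
  apply: (@le_trans _ _ (normc z ^+ n * ratio ^+ 'C(n, 2))).
    rewrite ler_wpM2l ?exprn_ge0 ?normc_ge0 //.
    apply: le_trans (normc_qX_le _) _.
    by rewrite ler_wiXn2l // binS leq_addr.
  by apply: le_trans (h1 n) _; rewrite ler_wpM2r // lerDl.
rewrite jacobi_term_neg Normc.normcM -exprVn normcX.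
apply: (@le_trans _ _ (normc z^-1 ^+ n.+1 * ratio ^+ 'C(n.+1, 2))).
  by rewrite ler_wpM2l ?exprn_ge0 ?normc_ge0 // normc_qX_le.
by apply: le_trans (h2 n.+1) _; rewrite ler_wpM2r // lerDr.
Qed.

Lemma jacobi_bisum_cvg : exists l : R[i], bisum_to term l.
Proof.
have [C C0 hC] := jacobi_term_bound.
have /andP[r0 r1] := ratio_itv.
have r2 : 0 <= ratio ^+ 2 < 1.
  by rewrite exprn_ge0 ?exprn_ilt1 // ltW.
have [lp hp] := cvg_geometric_series_normc r2 (fun n => (hC n).1).
have hm' n : normc (term (- n.+1%:Z)) <= (C * ratio ^+ 2) * (ratio ^+ 2) ^+ n.
  by rewrite -mulrA -exprS; exact: (hC n).2.
have [lm hm] := cvg_geometric_series_normc r2 hm'.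
exists (lm + lp); rewrite /bisum_to.
apply: (@cvgD _ R[i]^o).
  exact: (cvg_comp _ _ cvg_fst hm).
exact: (cvg_comp _ _ cvg_snd hp).
Qed.

(** The term of index [k] contributes at most
    [C * ratio ^ (2 * k) * (D * ratio ^ (N - k))], which is
    [C * D * ratio ^ N * ratio ^ k], and the [ratio ^ k] are summable. *)
Lemma jacobi_product_sum_dist : exists K : R, forall N,
  normc (\prod_(n < N)
           ((1 + z * q ^+ n.+1) * (1 + z^-1 * q ^+ n) * (1 - q ^+ n.+1)) -
         (\sum_(m < N) term (- m.+1%:Z) + \sum_(n < N.+1) term n%:Z))
  <= K * ratio ^+ N.
Proof.
have [C C0 hC] := jacobi_term_bound.
have [D D0 hD] := jacobi_weight_near1.
have r01 := ratio_itv; have [r0 r1] := andP r01; have r0' := ltW r0.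
exists (C * D * (1 - ratio)^-1 + C * D * (1 - ratio)^-1) => N.
rewrite finite_jacobi //; last exact: onem_expr_neq0.
have termE k (x : R[i]) : (k <= N)%N -> normc x <= C * (ratio ^+ 2) ^+ k ->
    normc (x * jacobi_weight q N k - x) <= C * D * ratio ^+ N * ratio ^+ k.
  move=> kN hx; rewrite -[X in _ - X]mulr1 -mulrBr Normc.normcM.
  have -> : C * D * ratio ^+ N * ratio ^+ k
     = C * (ratio ^+ 2) ^+ k * (D * ratio ^+ (N - k)).
    by rewrite -[in ratio ^+ N](subnK kN) exprD -exprM mul2n -addnn exprD; ring.
  by rewrite ler_pM ?normc_ge0 ?hD.
rewrite opprD addrACA -!sumrB mulrDl.
have CDN : 0 <= C * D * ratio ^+ N by rewrite !mulr_ge0 ?exprn_ge0.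
apply: le_trans (le_normcD _ _) _; apply: lerD.
  apply: le_trans (normc_sum _ _ _) _.
  apply: (@le_trans _ _ (\sum_(m < N) C * D * ratio ^+ N * ratio ^+ m)).
    apply: ler_sum => m _; apply: le_trans (termE m.+1 _ _ _) _ => //.
    - exact: (hC m).2.
    - by rewrite ler_wpM2l // exprS ler_piMl ?exprn_ge0 // ltW.
  rewrite -mulr_sumr [leRHS]mulrAC; apply: ler_wpM2l => //; exact: sum_expr_le.
apply: le_trans (normc_sum _ _ _) _.
apply: (@le_trans _ _ (\sum_(n < N.+1) C * D * ratio ^+ N * ratio ^+ n)).
  apply: ler_sum => n _; apply: termE; first by rewrite -ltnS.
  exact: (hC n).1.
rewrite -mulr_sumr [leRHS]mulrAC; apply: ler_wpM2l => //; exact: sum_expr_le.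
Qed.

End Convergence.

Theorem theorem3p7 (R : realType) (z q : R[i]) (hz : z != 0) (hq : `|q| < 1) :
  exists l : R[i],
    infprod_to
      (fun n : nat =>
         (1 + z * q ^+ n.+1) * (1 + z^-1 * q ^+ n) * (1 - q ^+ n.+1)) l
    /\ bisum_to
      (fun n : int => z ^ n * q ^ (((n ^+ 2 + n)%R %/ 2)%Z)) l.
Proof.
have [l hl] := jacobi_bisum_cvg z hq.
exists l; split; last exact: hl.
have [K hK] := jacobi_product_sum_dist hz hq.
have /andP[r0 r1] := ratio_itv hq.
apply: (cvg_geometric_dist _ hK); first by rewrite ltW.
(* The partial sums that the products are compared with run over
   [-N <= n < N + 1]. *)
have diag : (fun N : nat => (N, N.+1)) @ \oo --> (\oo, \oo).
  apply: cvg_pair; first exact: cvg_id.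
  exact: (cvg_addnl 1).
exact: (cvg_comp _ _ diag hl).
Qed.
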